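(* Let $t$ be a positive integer and let $G$ be a connected graph with the following five properties: (P1) $\chi(N_1(v))\ge t-2$ for any vertex $v$ of $G$; (P2) $\chi(N_1(I))\ge t-1$ for any maximum independent set $I$ of $G$; (P3) $|V(G)|\le t\,\alpha_1(G)-t$; (P4) any two different maximum independent sets of $G$ intersect in exactly one vertex; (P5) $\chi(G)\ge t$. Then $$\chi_c(G)\ge \frac{|V(G)|}{\alpha_1(G)-\frac{t-1}{t}}.$$
   Context: Graphs are finite, simple and undirected. For positive integers $k\ge 2d$, a $(k,d)$-coloring of $G$ is a map $f:V(G)\to\{0,1,\dots,k-1\}$ such that $d\le |f(x)-f(y)|\le k-d$ for every edge $xy$; $G$ is $(k,d)$-colorable if it has one. The circular chromatic number is $\chi_c(G)=\inf\{k/d: G\text{ is }(k,d)\text{-colorable}\}$. For $S\subseteq V(G)$, $N_1(S)=\{w\in V(G)\setminus S: ws\in E(G)\text{ for some }s\in S\}$, and $N_1(v)=N_1(\{v\})$. $\chi(G)$ is the (ordinary) chromatic number, and $\chi(S)$ for $S\subseteq V(G)$ denotes the chromatic number of the subgraph induced by $S$. $\alpha_1(G)$ is the independence number of $G$ (the maximum size of an independent set); a maximum independent set is an independent set of size $\alpha_1(G)$. *)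

(* Defs.v *)
From mathcomp Require Import all_boot all_order all_algebra.
From mathcomp Require Import classical_sets reals.

Set Implicit Arguments.
Unset Strict Implicit.
Unset Printing Implicit Defensive.

Import Order.TTheory GRing.Theory Num.Theory.

Record sgraph : Type := SGraph {
  vertex :> finType;
  edge : rel vertex;
  edge_sym : symmetric edge;
  edge_irr : irreflexive edge }.

Definition connected_graph (G : sgraph) : Prop :=
  0 < #|G| /\ forall x y : G, connect (@edge G) x y.

Section Induced.
Variables (G : sgraph) (S : {set G}).

Definition induced_edge : rel {x : G | x \in S} :=
  fun x y => edge (val x) (val y).

Lemma induced_sym : symmetric induced_edge.
Proof. by move=> x y; apply: edge_sym. Qed.

Lemma induced_irr : irreflexive induced_edge.
Proof. by move=> x; apply: edge_irr. Qed.

Definition induced : sgraph := SGraph induced_sym induced_irr.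

End Induced.

Definition colorable (G : sgraph) (n : nat) : bool :=
  [exists f : {ffun G -> 'I_n},
    [forall x, forall y, edge x y ==> (f x != f y)]].

Lemma colorable_card (G : sgraph) : exists n, colorable G n.
Proof.
exists #|G|; apply/existsP; exists [ffun x => enum_rank x].
apply/forallP => x; apply/forallP => y; apply/implyP => exy; rewrite !ffunE.
by apply: contraTneq exy => /enum_rank_inj ->; rewrite edge_irr.
Qed.

Definition chi (G : sgraph) : nat := ex_minn (colorable_card G).

Definition chi_on (G : sgraph) (S : {set G}) : nat := chi (induced S).

Definition N1 (G : sgraph) (S : {set G}) : {set G} :=
  [set w | (w \notin S) && [exists s in S, edge w s]].

Definition independent (G : sgraph) (S : {set G}) : bool :=
  [forall x in S, forall y in S, ~~ edge x y].

Definition alpha1 (G : sgraph) : nat :=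
  \max_(S : {set G} | independent S) #|S|.

Definition max_independent (G : sgraph) (S : {set G}) : bool :=
  independent S && (#|S| == alpha1 G).

(* Meaningful for [0 < d] and [2 * d <= k] only; then [k - d] is not truncated. *)
Definition kd_colorable (G : sgraph) (k d : nat) : Prop :=
  exists f : G -> 'I_k, forall x y : G, edge x y ->
    d <= absz ((f x)%:Z - (f y)%:Z)%R <= k - d.

(* The set is nonempty and bounded below, so [inf] is its true infimum. *)
Definition chi_c (R : realType) (G : sgraph) : R :=
  inf [set q : R | exists k d : nat,
    [/\ 0 < d, 2 * d <= k, kd_colorable G k d & q = (k%:R / d%:R)%R]]%classic.

(* Main.v *)
Require Import Defs.
From mathcomp Require Import all_boot all_order all_algebra.
From mathcomp Require Import classical_sets reals.
From mathcomp Require Import zify.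

Set Implicit Arguments.
Unset Strict Implicit.
Unset Printing Implicit Defensive.

Import Order.TTheory GRing.Theory Num.Theory.

(** Write [n], [alpha] for the numbers [#|G|], [alpha1 G]. It is enough to show
    [n * d / k <= alpha - (t - 1) / t] for each (k,d)-coloring [f] of [G]. A
    window, that is the set of vertices whose colors lie in an arc of [d]
    consecutive residues modulo [k], is independent, so it has at most [alpha]
    vertices. The [k] windows have [n * d / k] vertices on average, because each
    vertex lies in exactly [d] of them ([sum_card_window]); so the claim says
    that on average a window falls short of [alpha] by [(t - 1) / t].

    If [t * d <= k] then [n * d / k <= n / t], and [P3] suffices. If
    [k <= (t - 1) * d] then [t - 1] windows cover [G], which contradicts [P5].
    Otherwise fix a starting color and take [t] windows in arithmetic
    progression of step [d]. They wind around the color circle a little more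
    than once, so only the first and the last of them overlap. It is enough that
    their cardinals sum to at most [t * alpha - (t - 1)]
    ([sum_window_progression]): one then averages over the starting color. This
    bound is clear if at most one of the [t] windows is a maximum independent
    set. By [P4] any two maximum independent sets meet, equal ones because
    [0 < alpha]; hence two maximum windows can only be the first and the last.
    - If these are different sets, they share exactly one vertex, so the
      cardinals sum to at most [n + 1], and [P3] concludes.
    - If they are the same set, then the last window can be dropped from the
      cover of [G] by the [t] windows; hence [G] is (t-1)-colorable, which
      contradicts [P5]. *)

(** * Sums over residues and over families of sets *)

Lemma sum_modn_shift (F : nat -> nat) k a :
  \sum_(i < k) F ((i + a) %% k) = \sum_(i < k) F i.
Proof.
elim: a => [|a IHa].
  by apply: eq_bigr => i _; rewrite addn0 modn_small.
rewrite -IHa; case: k {IHa} => [|k]; first by rewrite !big_ord0.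
rewrite big_ord_recr big_ord_recl /= addnC; congr (_ + _).
  by congr F; rewrite add0n -addSnnS modnDl.
by apply: eq_bigr => i _; rewrite /bump /= add1n addSnnS.
Qed.

(** Replacing the two end sets by their union gives a disjoint family, and
    inclusion-exclusion for the two ends contributes the correction term. *)
Lemma sum_card_disjoint_but_ends (T : finType) n (W : nat -> {set T}) :
    (forall j l x, j < l < n.+2 -> x \in W j -> x \in W l ->
       j = 0 /\ l = n.+1) ->
  \sum_(j < n.+2) #|W j| <= #|T| + #|W 0 :&: W n.+1|.
Proof.
move=> disjW.
(* Index 0 stands for the union of both ends. *)
pose F (j : 'I_n.+1) := if j == ord0 then W 0 :|: W n.+1 else W j.
have ltF (j l : 'I_n.+1) : j < l -> [disjoint F j & F l].
  move=> ltjl; apply/pred0P => x /=; apply/negbTE/negP => /andP[].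
  have -> : F l = W l by rewrite /F -val_eqE /= eqn0Ngt (leq_ltn_trans _ ltjl).
  rewrite /F; case: eqP => [j0|_] Wj Wl; last first.
    by have := disjW j l x; have := ltn_ord l; move=> ? /(_ _ Wj Wl) []; lia.
  have ltl := ltn_ord l; move: ltjl; rewrite j0 /= => l_gt0.
  case/setUP: Wj => Wj.
    by have [] := disjW 0 l x _ Wj Wl; lia.
  by have [] := disjW l n.+1 x _ Wl Wj; lia.
have disjF (j l : 'I_n.+1) : j != l -> [disjoint F j & F l].
  rewrite -val_eqE neq_ltn => /orP[] /ltF //.
  by rewrite disjoint_sym.
have := partition_disjoint_bigcup addn (fun=> 1) disjF.
rewrite sum1_card => eqF.
have : \sum_j #|F j| <= #|T|.
  under eq_bigr => j _ do rewrite -sum1_card.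
  by rewrite -eqF max_card.
have -> : \sum_j #|F j| = #|W 0 :|: W n.+1| + \sum_(i < n) #|W i.+1|.
  by rewrite big_ord_recl.
have -> : \sum_(j < n.+2) #|W j| = #|W 0| + (\sum_(i < n) #|W i.+1| + #|W n.+1|).
  by rewrite big_ord_recl big_ord_recr.
have := cardsUI (W 0) (W n.+1).
lia.
Qed.

(** * Independent sets and colorings *)

Lemma independent_card (G : sgraph) (S : {set G}) :
  independent S -> #|S| <= alpha1 G.
Proof. exact: (@leq_bigmax_cond _ _ (fun S : {set G} => #|S|)). Qed.

Lemma alpha1_gt0 (G : sgraph) : 0 < #|G| -> 0 < alpha1 G.
Proof.
case/card_gt0P => x _; rewrite -(cards1 x); apply: independent_card.
apply/forall_inP => y /set1P ->; apply/forall_inP => z /set1P ->.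
by rewrite edge_irr.
Qed.

Lemma colorable_cover (G : sgraph) n (W : nat -> {set G}) :
    (forall j, independent (W j)) ->
    (forall x, exists2 j, j < n & x \in W j) ->
  colorable G n.
Proof.
move=> indW covW.
have {}covW x : exists j : 'I_n, x \in W j.
  by have [j ltjn Wx] := covW x; exists (Ordinal ltjn).
apply/existsP; exists [ffun x => xchoose (covW x)].
apply/forallP => x; apply/forallP => y; apply/implyP => exy.
rewrite !ffunE; apply: contraTneq exy => eq_c.
have Wx := xchooseP (covW x); have := xchooseP (covW y); rewrite -eq_c => Wy.
exact: (forall_inP (forall_inP (indW _) _ Wx) _ Wy).
Qed.

Lemma leq_chi (G : sgraph) n : colorable G n -> chi G <= n.
Proof. by rewrite /chi; case: ex_minnP => m _; apply. Qed.

(** * Windows of a (k,d)-coloring *)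

Section Windows.

Variables (G : sgraph) (k d : nat) (f : G -> 'I_k).
Hypothesis d_gt0 : 0 < d.
Hypothesis fP : forall x y : G, edge x y ->
  d <= absz ((f x)%:Z - (f y)%:Z)%R <= k - d.

(** These are the vertices with color in the cyclic interval of length [d] that
    starts at [- a]; adding [a] avoids truncated subtraction, at the cost of
    running around the circle backwards as [a] grows. *)
Definition window a : {set G} := [set x | (f x + a) %% k < d].

(** A vertex at position [u < d] in one window has position [u + e] in the
    window shifted by [e]; the bound on [e] prevents this sum from wrapping. It
    serves both for the independence and for the disjointness of windows. *)
Lemma window_step a e x :
  x \in window a -> e + d <= k -> x \in window (a + e) -> e < d.
Proof.
rewrite !inE addnA -(modnDml (f x + a)).
move: ((f x + a) %% k) => u u_lt e_le.
by rewrite modn_small => [ue_lt|]; lia.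
Qed.

(** If the window contained adjacent [x] and [y] with [f x <= f y], then shifting
    by [f y - f x] would keep [x] inside, so that the colors would differ by less
    than [d]. *)
Lemma window_independent a : independent (window a).
Proof.
have noedge x y : x \in window a -> y \in window a -> f x <= f y -> ~~ edge x y.
  move=> Wx Wy lexy; apply/negP => /fP fxy.
  have : (f y - f x) < d; last by lia.
  apply: (@window_step a (f y - f x) x) => //; first by lia.
  by move: Wy; rewrite !inE; have -> : f x + (a + (f y - f x)) = f y + a by lia.
apply/forall_inP => x Wx; apply/forall_inP => y Wy.
by case: (leqP (f x) (f y)) => [|/ltnW] le; [|rewrite edge_sym]; apply: noedge.
Qed.

Lemma window_cover n i x :
  k <= n * d -> exists2 j, j < n & x \in window (i + j * d).
Proof.
move=> le_k; have k_gt0 : 0 < k by apply: leq_ltn_trans (ltn_ord (f x)).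
have n_gt0 : 0 < n by case: n le_k => //; lia.
have ltc := ltn_pmod (f x + i) k_gt0.
have [c_lt|c_ge] := ltnP ((f x + i) %% k) d.
  by exists 0; rewrite // inE mul0n addn0.
set c := (f x + i) %% k in ltc c_ge.
have eqq := divn_eq (k - 1 - c) d; have ltr := ltn_pmod (k - 1 - c) d_gt0.
(* The number of steps is the ceiling of [(k - c) / d], the first with which
   the position [c] reaches [k]. *)
exists ((k - 1 - c) %/ d).+1.
  have : ((k - 1 - c) %/ d).+1 * d < n * d by lia.
  by rewrite ltn_pmul2r.
rewrite inE addnA -modnDml -/c.
have -> : c + ((k - 1 - c) %/ d).+1 * d = k + (d - 1 - (k - 1 - c) %% d) by lia.
by rewrite modnDl (leq_ltn_trans (leq_mod _ _)) //; lia.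
Qed.

Lemma sum_card_window b : d <= k -> \sum_(i < k) #|window (i + b)| = #|G| * d.
Proof.
move=> le_dk.
under eq_bigr => i _.
  rewrite -sum1_card big_mkcond /=.
  under eq_bigr => x _ do rewrite inE addnCA.
  over.
rewrite exchange_big /= -sum_nat_const; apply: eq_bigr => x _.
rewrite (sum_modn_shift (fun u => if u < d then 1 else 0)).
rewrite -big_mkcond /= -(big_ord_widen_cond _ xpredT (fun=> 1) le_dk).
by rewrite sum1_card card_ord.
Qed.

(** Windows [e] steps apart, with [0 < e < t - 1], are disjoint since both ways
    around the circle their starting points are at least [d] apart. *)
Lemma window_disjoint t i j l x :
    t.-1 * d < k -> j < l < t ->
    x \in window (i + j * d) -> x \in window (i + l * d) ->
  j = 0 /\ l = t.-1.
Proof.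
move=> lt_k /andP[ltjl ltlt] Wj Wl.
have : ~~ (l - j < t.-1); last by lia.
apply/negP => lt_lj.
have le1 : (l - j).+1 * d <= t.-1 * d by rewrite leq_pmul2r.
have le2 : 1 * d <= (l - j) * d by rewrite leq_pmul2r //; lia.
have : (l - j) * d < d; last by lia.
apply: (@window_step (i + j * d) _ x) => //; first by lia.
by rewrite -addnA -mulnDl subnKC // ltnW.
Qed.

(** The heart of the proof: the progression falls short of [t * alpha1 G] by at
    least [t - 1], either because it contains at most one maximum independent
    set or because it counts a single vertex twice. *)
Lemma sum_window_progression t i :
    t.-1 * d < k < t * d -> 2 * d <= k ->
    0 < alpha1 G -> #|G| <= t * alpha1 G - t -> t <= chi G ->
    (forall I J : {set G}, max_independent I -> max_independent J ->
       I <> J -> #|I :&: J| = 1) ->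
  \sum_(j < t) #|window (i + j * d)| <= (t * alpha1 G - t).+1.
Proof.
move=> /andP[lt_k k_lt] le2dk a_gt0 leG le_chi meet1.
have t_ge3 : 2 < t by rewrite -(ltn_pmul2r d_gt0); lia.
case: t => [|[|n]] // in lt_k k_lt leG le_chi t_ge3 *.
set W := fun j => window (i + j * d).
rewrite -[leqLHS]/(\sum_(j < n.+2) #|W j|).
have indW j : independent (W j) by apply: window_independent.
have disjW j l x : j < l < n.+2 -> x \in W j -> x \in W l -> j = 0 /\ l = n.+1.
  exact: window_disjoint.
have [/andP[max0 maxl]|not_both] :=
    boolP (max_independent (W 0) && max_independent (W n.+1)).
  (* If both ends coincide, the last window is redundant in the cover. *)
  have [eqW|/eqP neqW] := eqVneq (W 0) (W n.+1).
    suff /leq_chi : colorable G n.+1 by lia.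
    apply: (@colorable_cover _ _ W) => // x.
    have [j ltj Wx] := window_cover i x (ltnW k_lt).
    move: ltj; rewrite ltnS leq_eqVlt => /orP[/eqP jE|ltj]; last by exists j.
    by exists 0; rewrite // eqW /W -jE.
  apply: leq_trans (sum_card_disjoint_but_ends disjW) _.
  by rewrite meet1 // addn1.
have one_max (j l : 'I_n.+2) : j < l ->
    ~~ (max_independent (W j) && max_independent (W l)).
  move=> ltjl; apply/negP => /andP[maxj maxl].
  have [I0|[x /setIP[Wj Wl]]] := set_0Vmem (W j :&: W l).
    have neqW : W j <> W l.
      move=> eqW; move: I0 maxj; rewrite -eqW finset.setIid => ->.
      by rewrite /max_independent cards0 => /andP[_]; lia.
    by have := meet1 _ _ maxj maxl neqW; rewrite I0 cards0.
  have [|j0 ll] := disjW j l x _ Wj Wl; first by rewrite ltjl ltn_ord.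
  by move: not_both maxj maxl; rewrite j0 ll => /[swap] -> /[swap] ->.
have eq_bound : n.+2 * alpha1 G - n.+2 = n.+2 * (alpha1 G).-1.
  by rewrite -subn1 mulnBr muln1.
have le_a j : #|W j| <= alpha1 G by apply: independent_card.
have lt_a j : ~~ max_independent (W j) -> #|W j| <= (alpha1 G).-1.
  by rewrite /max_independent indW /= => neq; have := le_a j; lia.
have [j0 maxj0|no_max] := pickP (fun j : 'I_n.+2 => max_independent (W j)).
  rewrite (bigD1 j0) //=.
  have le_rest : \sum_(j < n.+2 | j != j0) #|W j| <= n.+1 * (alpha1 G).-1.
    apply: (@leq_trans (\sum_(j < n.+2 | j != j0) (alpha1 G).-1)).
      apply: leq_sum => j neq; apply: lt_a; apply/negP => maxj.
      move: neq; rewrite -val_eqE neq_ltn.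
      by case/orP => /one_max; rewrite maxj maxj0.
    by rewrite sum_nat_const cardC1 card_ord.
  apply: leq_trans (leq_add (le_a j0) le_rest) _.
  by rewrite eq_bound [n.+2 * _]mulSn; lia.
rewrite leqW // eq_bound -[n.+2 in leqRHS]card_ord -sum_nat_const.
by apply: leq_sum => j _; apply: lt_a; rewrite no_max.
Qed.

End Windows.

(** * The lower bound *)

(** The inequality [#|G| / (alpha1 G - (t - 1) / t) <= k / d] without
    denominators. *)
Lemma kd_colorable_bound (G : sgraph) t k d :
    0 < t -> 0 < d -> 2 * d <= k -> kd_colorable G k d ->
    0 < alpha1 G -> #|G| <= t * alpha1 G - t -> t <= chi G ->
    (forall I J : {set G}, max_independent I -> max_independent J ->
       I <> J -> #|I :&: J| = 1) ->
  t * (#|G| * d) <= k * (t * alpha1 G - t).+1.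
Proof.
move=> t_gt0 d_gt0 le2dk [f fP] a_gt0 leG le_chi meet1.
have [le_k|k_lt] := leqP (t * d) k.
  rewrite mulnCA mulnC; apply: leq_mul => //; exact: leqW.
have lt_k : t.-1 * d < k.
  rewrite ltnNge; apply/negP => le_k.
  suff /leq_chi : colorable G t.-1 by lia.
  apply: (@colorable_cover _ _ (fun j => window d f (0 + j * d))) => [j|x].
    exact: window_independent.
  exact: window_cover.
have -> : t * (#|G| * d) = \sum_(i < k) \sum_(j < t) #|window d f (i + j * d)|.
  (* For each [j] the starting points [i + j * d] run over all residues. *)
  rewrite exchange_big /=.
  have le_dk : d <= k by lia.
  under eq_bigr => j _ do rewrite sum_card_window //.
  by rewrite sum_nat_const card_ord.
rewrite -[k in leqRHS]card_ord -sum_nat_const.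
apply: leq_sum => i _; apply: sum_window_progression => //.
by rewrite lt_k.
Qed.

(** This makes the set of ratios nonempty, which a lower bound on its infimum
    requires since [inf] of the empty set is a default value. Distinct colors
    below [#|G|] suffice; the two extra colors ensure [2 * 1 <= k]. *)
Lemma kd_colorable_card (G : sgraph) : kd_colorable G #|G|.+2 1.
Proof.
exists (fun x => widen_ord (leqW (leqnSn _)) (enum_rank x)) => x y exy /=.
have neq : enum_rank x != enum_rank y :> nat.
  by apply: contraTneq exy => /val_inj/enum_rank_inj ->; rewrite edge_irr.
have dist_bounds (m i j : nat) : i != j -> i < m -> j < m ->
    0 < absz (i%:Z - j%:Z)%R <= m.+2 - 1 by lia.
exact: dist_bounds neq (ltn_ord _) (ltn_ord _).
Qed.

Theorem theorem13 (R : realType) (t : nat) (G : sgraph)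
  (t_gt0 : 0 < t)
  (G_conn : connected_graph G)
  (P1 : forall v : G, t - 2 <= chi_on (N1 [set v]%SET))
  (P2 : forall I : {set G}, max_independent I -> t - 1 <= chi_on (N1 I))
  (P3 : (#|G|%:Z <= t%:Z * (alpha1 G)%:Z - t%:Z)%R)
  (P4 : forall I J : {set G}, max_independent I -> max_independent J ->
          I <> J -> #|I :&: J| = 1)
  (P5 : t <= chi G) :
  (#|G|%:R / ((alpha1 G)%:R - (t%:R - 1) / t%:R) <= chi_c R G)%R.
Proof.
have a_gt0 : 0 < alpha1 G by apply: alpha1_gt0; case: G_conn.
have leta : t <= t * alpha1 G by rewrite leq_pmulr.
have leG : #|G| <= t * alpha1 G - t by lia.
apply: lb_le_inf.
  exists (#|G|.+2%:R / 1%:R)%R, #|G|.+2, 1.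
  by split=> //; apply: kd_colorable_card.
move=> _ [k [d [d_gt0 le2dk col ->]]].
have bound := kd_colorable_bound t_gt0 d_gt0 le2dk col a_gt0 leG P5 P4.
have tR : (0 < t%:R :> R)%R by rewrite ltr0n.
have dR : (0 < d%:R :> R)%R by rewrite ltr0n.
have -> : ((alpha1 G)%:R - (t%:R - 1) / t%:R
           = (t * alpha1 G - t).+1%:R / t%:R :> R)%R.
  rewrite -natr1 natrB // natrM; apply: (mulIf (lt0r_neq0 tR)).
  by rewrite mulrBl !divfK ?lt0r_neq0 // opprB addrA addrAC mulrC.
rewrite invf_div mulrA ler_pdivrMr ?ltr0n // mulrAC ler_pdivlMr //.
by rewrite -!natrM ler_nat -mulnA mulnCA.
Qed.
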